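(* Let $N\ge 1$ and regard $M_N(\mathbb{H})$ as a real $*$-algebra. Put $$\Psi' = \begin{pmatrix} I_{N^2-1} & 0 \\ 0 & -I_{N(N-1)} \end{pmatrix}\in M_{(2N+1)(N-1)}(\mathbb{C}),\qquad \Theta' = \begin{pmatrix} I_{N^2} & 0 \\ 0 & -I_{N(N+1)} \end{pmatrix}\in M_{N(2N+1)}(\mathbb{C}),$$ and $$V = \left\{ v \in \mathbb{C}^{(2N+1)(N-1)} \mid \overline{v} = v \Psi' \right\},$$ $$S = \left\{ B \in M_{(2N+1)(N-1)}(\mathbb{C}) \mid \Psi' \overline{B} = B \Psi' \right\},$$ $$T = \left\{ C \in M_{N(2N+1)}(\mathbb{C}) \mid \Theta' \overline{C} = C \Theta' \right\},$$ where elements of $V$ are row vectors and $S,T$ are semigroups under matrix multiplication. Then there is an isomorphism of semigroups $$\operatorname{Pert}(M_N(\mathbb{H})) \cong \left( V \rtimes S \right) \times T,$$ where $V\rtimes S$ is the set $V\times S$ with the semigroup law $(v,B)\cdot(v',B')=(v'+vB',BB')$.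
   Context: Bars denote entrywise complex conjugation. $\mathbb{H}$ is the real algebra of quaternions and the involution on $M_N(\mathbb{H})$ is quaternionic conjugate transposition. For a real associative unital $*$-algebra $\mathcal{A}$, the opposite algebra $\mathcal{A}^\circ$ is the vector space $\mathcal{A}$, with elements written $a^\circ$, and product $a^\circ b^\circ=(ba)^\circ$. The perturbation semigroup $\operatorname{Pert}(\mathcal{A})$ is the set of elements of $\mathcal{A}\otimes_{\mathbb{R}}\mathcal{A}^\circ$ of the form $\sum_j a_j\otimes b_j^\circ$ (finite sum) with $\sum_j a_jb_j=1$ and $\sum_j a_j\otimes b_j^\circ=\sum_j b_j^*\otimes a_j^{*\circ}$; it is a unital semigroup under the multiplication of $\mathcal{A}\otimes_{\mathbb{R}}\mathcal{A}^\circ$. *)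

(* Defs.v *)
From HB Require Import structures.
From mathcomp Require Import all_boot all_order all_algebra.
From mathcomp Require Import generic_quotient.
From mathcomp Require Import boolp reals.
From mathcomp Require Import complex.
From mathcomp Require Import ring zify.

Set Implicit Arguments.
Unset Strict Implicit.
Unset Printing Implicit Defensive.

Import GRing.Theory.
Local Open Scope ring_scope.
Local Open Scope quotient_scope.

Section TensorDef.
Variables (R : comNzRingType) (A B : lmodType R).

(* A formal sum [:: (a_1, b_1); ...; (a_k, b_k)] stands for the tensor
   a_1 ⊗ b_1 + ... + a_k ⊗ b_k; [tens_eq] is the congruence of the monoid of
   formal sums generated by commutativity and bilinearity.  The rule
   [tens_eq0] makes 0 ⊗ b the empty sum: formal sums are a monoid and not a
   group, so that it does not follow from the other rules. *)
Inductive tens_eq : seq (A * B) -> seq (A * B) -> Prop :=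
| tens_eq_refl s : tens_eq s s
| tens_eq_sym s t : tens_eq s t -> tens_eq t s
| tens_eq_trans s t u : tens_eq s t -> tens_eq t u -> tens_eq s u
| tens_eq_cat s s' t t' :
    tens_eq s s' -> tens_eq t t' -> tens_eq (s ++ t) (s' ++ t')
| tens_eq_catC s t : tens_eq (s ++ t) (t ++ s)
| tens_eqDl a a' b : tens_eq [:: (a + a', b)] [:: (a, b); (a', b)]
| tens_eqDr a b b' : tens_eq [:: (a, b + b')] [:: (a, b); (a, b')]
| tens_eqZ r a b : tens_eq [:: (r *: a, b)] [:: (a, r *: b)]
| tens_eq0 b : tens_eq [:: (0, b)] [::].

Definition tens_rel : rel (seq (A * B)) := fun s t => `[< tens_eq s t >].

Lemma tens_rel_refl : reflexive tens_rel.
Proof. by move=> s; apply/asboolP/tens_eq_refl. Qed.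

Lemma tens_rel_sym : symmetric tens_rel.
Proof. by move=> s t; apply/asboolP/asboolP => /tens_eq_sym. Qed.

Lemma tens_rel_trans : transitive tens_rel.
Proof.
by move=> s t u /asboolP ts /asboolP su; apply/asboolP/(tens_eq_trans ts su).
Qed.

Canonical tens_equiv := EquivRel tens_rel tens_rel_refl tens_rel_sym tens_rel_trans.

Definition tensor : Type := {eq_quot tens_equiv}.
HB.instance Definition _ := Choice.on tensor.

Definition tens_class (s : seq (A * B)) : tensor := \pi_({eq_quot tens_equiv}) s.
Definition tens_repr (x : tensor) : seq (A * B) := repr (x : {eq_quot tens_equiv}).

Lemma tens_reprK : cancel tens_repr tens_class.
Proof. exact: reprK. Qed.

Lemma tens_classP s t : tens_class s = tens_class t <-> tens_eq s t.
Proof.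
split; last by move=> st; apply/eqmodP/asboolP.
by move=> /eqmodP /asboolP.
Qed.

Lemma repr_classP s : tens_eq (tens_repr (tens_class s)) s.
Proof. by apply/tens_classP; rewrite tens_reprK. Qed.

Lemma tensor_ind (P : tensor -> Prop) :
  (forall s, P (tens_class s)) -> forall x, P x.
Proof. by move=> Ps x; rewrite -[x]tens_reprK; apply: Ps. Qed.

Definition tens_add (x y : tensor) := tens_class (tens_repr x ++ tens_repr y).
Definition tens_zero : tensor := tens_class [::].
Definition tens_scale (r : R) (x : tensor) :=
  tens_class [seq (r *: p.1, p.2) | p <- tens_repr x].

Lemma tens_addE s t : tens_add (tens_class s) (tens_class t) = tens_class (s ++ t).
Proof. by apply/tens_classP/tens_eq_cat; apply: repr_classP. Qed.

Lemma tens_eq_scale r s t : tens_eq s t ->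
  tens_eq [seq (r *: p.1, p.2) | p <- s] [seq (r *: p.1, p.2) | p <- t].
Proof.
elim=> {s t} /=.
- by move=> s; apply: tens_eq_refl.
- by move=> s t _ /tens_eq_sym.
- by move=> s t u _ st _ tu; apply: tens_eq_trans st tu.
- by move=> s s' t t' _ ss' _ tt'; rewrite !map_cat; apply: tens_eq_cat.
- by move=> s t; rewrite !map_cat; apply: tens_eq_catC.
- by move=> a a' b; rewrite scalerDr; apply: tens_eqDl.
- by move=> a b b'; apply: tens_eqDr.
- by move=> q a b; rewrite scalerA mulrC -scalerA; apply: tens_eqZ.
- by move=> b; rewrite scaler0; apply: tens_eq0.
Qed.

Lemma tens_scaleE r s :
  tens_scale r (tens_class s) = tens_class [seq (r *: p.1, p.2) | p <- s].
Proof. by apply/tens_classP/tens_eq_scale/repr_classP. Qed.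

Lemma tens_addA : associative tens_add.
Proof.
elim/tensor_ind=> s; elim/tensor_ind=> t; elim/tensor_ind=> u.
by rewrite !tens_addE catA.
Qed.

Lemma tens_addC : commutative tens_add.
Proof.
elim/tensor_ind=> s; elim/tensor_ind=> t; rewrite !tens_addE.
exact/tens_classP/tens_eq_catC.
Qed.

Lemma tens_add0 : left_id tens_zero tens_add.
Proof. by elim/tensor_ind=> s; rewrite tens_addE. Qed.

Lemma tens_addN : left_inverse tens_zero (tens_scale (-1)) tens_add.
Proof.
elim/tensor_ind=> s; rewrite tens_scaleE tens_addE.
elim: s => [//|[a b] s IHs].
rewrite map_cons -cat1s -[X in _ ++ X]cat1s /=.
set t := map _ s in IHs *.
have -> : tens_class ((-1 *: a, b) :: t ++ (a, b) :: s) =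
    tens_add (tens_class [:: (-1 *: a, b); (a, b)]) (tens_class (t ++ s)).
  rewrite tens_addE; apply/tens_classP; rewrite -cat1s -[X in tens_eq _ X]cat1s.
  apply: tens_eq_cat; first exact: tens_eq_refl.
  rewrite -cat1s -[_ :: t ++ s]cat1s !catA; apply: tens_eq_cat.
    exact: tens_eq_catC.
  exact: tens_eq_refl.
rewrite IHs tens_addC tens_add0; apply/tens_classP.
apply: tens_eq_trans (tens_eq0 b); apply: tens_eq_sym.
by rewrite -[X in tens_eq [:: (X, _)]](addNr a) -scaleN1r; exact: tens_eqDl.
Qed.

HB.instance Definition _ :=
  GRing.isZmodule.Build tensor tens_addA tens_addC tens_add0 tens_addN.

Lemma tens_classD s t : tens_class (s ++ t) = tens_class s + tens_class t.
Proof. by rewrite -tens_addE. Qed.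

Lemma tens_scaleA a b v : tens_scale a (tens_scale b v) = tens_scale (a * b) v.
Proof.
elim/tensor_ind: v => s; rewrite !tens_scaleE -map_comp.
by congr tens_class; apply: eq_map => p /=; rewrite scalerA.
Qed.

Lemma tens_scale1 : left_id 1 tens_scale.
Proof.
elim/tensor_ind=> s; rewrite tens_scaleE; congr tens_class.
by rewrite -[RHS]map_id; apply: eq_map => -[a b] /=; rewrite scale1r.
Qed.

Lemma tens_scaleDr : right_distributive tens_scale +%R.
Proof.
move=> r; elim/tensor_ind=> s; elim/tensor_ind=> t.
by rewrite -tens_classD !tens_scaleE -tens_classD map_cat.
Qed.

Lemma tens_scaleDl v : {morph tens_scale^~ v : a b / a + b}.
Proof.
move=> r q; elim/tensor_ind: v => s /=; rewrite !tens_scaleE.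
elim: s => [|[a b] s IHs]; first by rewrite -tens_classD.
rewrite !map_cons /= -cat1s -[X in _ = tens_class X + _]cat1s.
rewrite -[X in _ = _ + tens_class X]cat1s !tens_classD IHs addrACA.
congr (_ + _); rewrite -tens_classD /= scalerDl; exact/tens_classP/tens_eqDl.
Qed.

HB.instance Definition _ := GRing.Zmodule_isLmodule.Build R tensor
  tens_scaleA tens_scale1 tens_scaleDr tens_scaleDl.

Definition tens (a : A) (b : B) : tensor := tens_class [:: (a, b)].

Lemma tens_classE s : tens_class s = \sum_(p <- s) tens p.1 p.2.
Proof.
elim: s => [|[a b] s IHs]; first by rewrite big_nil.
by rewrite big_cons -IHs -tens_classD.
Qed.

Lemma tensorE x : x = \sum_(p <- tens_repr x) tens p.1 p.2.
Proof. by rewrite -tens_classE tens_reprK. Qed.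

Lemma tensDl a a' b : tens (a + a') b = tens a b + tens a' b.
Proof. by rewrite -tens_classD; apply/tens_classP/tens_eqDl. Qed.

Lemma tensDr a b b' : tens a (b + b') = tens a b + tens a b'.
Proof. by rewrite -tens_classD; apply/tens_classP/tens_eqDr. Qed.

Lemma tensZl r a b : tens (r *: a) b = r *: tens a b.
Proof. by rewrite /GRing.scale /= tens_scaleE. Qed.

Lemma tensZr r a b : tens a (r *: b) = r *: tens a b.
Proof. by rewrite -tensZl; apply/tens_classP/tens_eq_sym/tens_eqZ. Qed.

Lemma tens0l b : tens 0 b = 0.
Proof. by apply: (addrI (tens 0 b)); rewrite -tensDl !addr0. Qed.

Lemma tens0r a : tens a 0 = 0.
Proof. by apply: (addrI (tens a 0)); rewrite -tensDr !addr0. Qed.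

End TensorDef.

Section TensorLift.
Variables (R : comNzRingType) (A B : lmodType R) (W : zmodType).
Variable f : A -> B -> W.
Hypotheses (fDl : forall a a' b, f (a + a') b = f a b + f a' b)
  (fDr : forall a b b', f a (b + b') = f a b + f a b')
  (fZ : forall r a b, f (r *: a) b = f a (r *: b)).

Definition tens_lift (x : tensor A B) : W :=
  \sum_(p <- tens_repr x) f p.1 p.2.

Lemma tens_eq_sum s t : tens_eq s t ->
  \sum_(p <- s) f p.1 p.2 = \sum_(p <- t) f p.1 p.2.
Proof.
elim=> {s t} //.
- by move=> s t u _ -> _ ->.
- by move=> s s' t t' _ ss' _ tt'; rewrite !big_cat /= ss' tt'.
- by move=> s t; rewrite !big_cat /= addrC.
- by move=> a a' b; rewrite !big_cons !big_nil /= fDl !addr0.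
- by move=> a b b'; rewrite !big_cons !big_nil /= fDr !addr0.
- by move=> r a b; rewrite !big_seq1 /= fZ.
- move=> b; rewrite big_seq1 big_nil /=; apply: (addrI (f 0 b)).
  by rewrite -fDl !addr0.
Qed.

Lemma tens_liftE s :
  tens_lift (\sum_(p <- s) tens p.1 p.2) = \sum_(p <- s) f p.1 p.2.
Proof. by rewrite -tens_classE; apply/tens_eq_sum/repr_classP. Qed.

Lemma tens_lift_tens a b : tens_lift (tens a b) = f a b.
Proof. by have := tens_liftE [:: (a, b)]; rewrite !big_seq1. Qed.

Lemma tens_liftD : {morph tens_lift : x y / x + y}.
Proof.
move=> x y; rewrite (tensorE x) (tensorE y) -big_cat !tens_liftE.
by rewrite big_cat.
Qed.

End TensorLift.

Section TensorAlg.
Variables (R : comNzRingType) (A B : algType R).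
Local Notation AB := (tensor A B).

Definition tens_mul (x y : AB) : AB :=
  \sum_(p <- tens_repr x) \sum_(q <- tens_repr y)
    tens (p.1 * q.1) (p.2 * q.2).

Lemma tens_mulE s t :
  tens_mul (\sum_(p <- s) tens p.1 p.2) (\sum_(q <- t) tens q.1 q.2) =
  \sum_(p <- s) \sum_(q <- t) tens (p.1 * q.1) (p.2 * q.2).
Proof.
rewrite /tens_mul -!tens_classE.
transitivity (\sum_(p <- tens_repr (tens_class s)) \sum_(q <- t)
    tens (p.1 * q.1) (p.2 * q.2)).
  apply: eq_bigr => p _.
  apply: (@tens_eq_sum R A B AB (fun a b => tens (p.1 * a) (p.2 * b)))
      (repr_classP t).
  - by move=> a a' b; rewrite mulrDr tensDl.
  - by move=> a b b'; rewrite mulrDr tensDr.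
  - by move=> r a b; rewrite -!scalerAr tensZl tensZr.
apply: (@tens_eq_sum R A B AB
  (fun a b => \sum_(q <- t) tens (a * q.1) (b * q.2))) (repr_classP s).
- by move=> a a' b; rewrite -big_split; apply: eq_bigr => q _; rewrite mulrDl tensDl.
- by move=> a b b'; rewrite -big_split; apply: eq_bigr => q _; rewrite mulrDl tensDr.
- by move=> r a b; apply: eq_bigr => q _; rewrite -!scalerAl tensZl tensZr.
Qed.

Lemma tens_mul_tens a b a' b' :
  tens_mul (tens a b) (tens a' b') = tens (a * a') (b * b').
Proof. by have := tens_mulE [:: (a, b)] [:: (a', b')]; rewrite !big_seq1. Qed.

Lemma tens_mulDl : left_distributive tens_mul +%R.
Proof.
move=> x y z; rewrite (tensorE x) (tensorE y) (tensorE z) -big_cat !tens_mulE.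
by rewrite big_cat.
Qed.

Lemma tens_mulDr : right_distributive tens_mul +%R.
Proof.
move=> x y z; rewrite (tensorE x) (tensorE y) (tensorE z) -big_cat !tens_mulE.
by rewrite -big_split; apply: eq_bigr => p _; rewrite big_cat.
Qed.

Lemma tens_mul0l : left_zero 0 tens_mul.
Proof. by move=> x; apply: (addrI (tens_mul 0 x)); rewrite -tens_mulDl !addr0. Qed.

Lemma tens_mul0r : right_zero 0 tens_mul.
Proof. by move=> x; apply: (addrI (tens_mul x 0)); rewrite -tens_mulDr !addr0. Qed.

Lemma tens_mul_suml I (s : seq I) (F : I -> AB) x :
  tens_mul (\sum_(i <- s) F i) x = \sum_(i <- s) tens_mul (F i) x.
Proof. by apply: (big_morph (tens_mul^~ x)) => [y z|]; rewrite ?tens_mulDl ?tens_mul0l. Qed.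

Lemma tens_mul_sumr I (s : seq I) (F : I -> AB) x :
  tens_mul x (\sum_(i <- s) F i) = \sum_(i <- s) tens_mul x (F i).
Proof. by apply: (big_morph (tens_mul x)) => [y z|]; rewrite ?tens_mulDr ?tens_mul0r. Qed.

Lemma tens_mulA : associative tens_mul.
Proof.
move=> x y z; rewrite (tensorE x) !tens_mul_suml; apply: eq_bigr => p _.
rewrite (tensorE y) tens_mul_suml !tens_mul_sumr tens_mul_suml.
apply: eq_bigr => q _.
rewrite (tensorE z) !tens_mul_sumr; apply: eq_bigr => u _.
by rewrite !tens_mul_tens !mulrA.
Qed.

Lemma tens_mul1l : left_id (tens 1 1) tens_mul.
Proof.
move=> x; rewrite (tensorE x) tens_mul_sumr; apply: eq_bigr => p _.
by rewrite tens_mul_tens !mul1r.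
Qed.

Lemma tens_mul1r : right_id (tens 1 1) tens_mul.
Proof.
move=> x; rewrite (tensorE x) tens_mul_suml; apply: eq_bigr => p _.
by rewrite tens_mul_tens !mulr1.
Qed.

HB.instance Definition _ := GRing.Zmodule_isPzRing.Build AB
  tens_mulA tens_mul1l tens_mul1r tens_mulDl tens_mulDr.

Lemma tensM a b a' b' :
  tens a b * tens a' b' = tens (a * a') (b * b') :> AB.
Proof. exact: tens_mul_tens. Qed.

Lemma tens1 : tens 1 1 = 1 :> AB.
Proof. by []. Qed.

Lemma sum_tensM (s t : seq (A * B)) :
  (\sum_(p <- s) tens p.1 p.2) * (\sum_(q <- t) tens q.1 q.2) =
  \sum_(p <- s) \sum_(q <- t) tens (p.1 * q.1) (p.2 * q.2) :> AB.
Proof. exact: tens_mulE. Qed.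

End TensorAlg.

(* [A^c] is the converse ring of the library, whose product is
   (a : A^c) * b = (b * a : A); it is given here the scaling of [A]. *)
Section Opposite.
Variables (R : comNzRingType) (A : algType R).

HB.instance Definition _ := GRing.Zmodule_isLmodule.Build R A^c
  (@scalerA R A) (@scale1r R A) (@scalerDr R A) (fun v a b => scalerDl v a b).

Lemma opp_scalerAl (r : R) (u v : A^c) : r *: (u * v) = (r *: u) * v.
Proof. exact: (@scalerAr R A r v u). Qed.

HB.instance Definition _ := GRing.Lmodule_isLalgebra.Build R A^c opp_scalerAl.

Lemma opp_scalerAr (r : R) (u v : A^c) : r *: (u * v) = u * (r *: v).
Proof. exact: (@scalerAl R A r v u). Qed.

HB.instance Definition _ := GRing.Lalgebra_isAlgebra.Build R A^c opp_scalerAr.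

End Opposite.

HB.mixin Record Algebra_isStar (R : pzRingType) A of GRing.Algebra R A := {
  star : A -> A;
  starK : involutive star;
  starD : {morph star : x y / x + y};
  starZ : forall (r : R) x, star (r *: x) = r *: star x;
  starM : forall x y, star (x * y) = star y * star x
}.

#[short(type="starAlgType")]
HB.structure Definition StarAlgebra (R : pzRingType) :=
  {A of Algebra_isStar R A & GRing.Algebra R A}.

Section Pert.
Variables (R : comNzRingType) (A : starAlgType R).

Definition in_pert (x : tensor A A^c) : Prop :=
  exists s : seq (A * A),
    [/\ x = \sum_(p <- s) tens p.1 (p.2 : A^c),
        \sum_(p <- s) p.1 * p.2 = 1 :> A
      & \sum_(p <- s) tens p.1 (p.2 : A^c) =
        \sum_(p <- s) tens (star p.2) (star p.1 : A^c)].

Record pert := Pert { pert_val :> tensor A A^c; _ : `[< in_pert pert_val >] }.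

HB.instance Definition _ := [isSub for pert_val].
HB.instance Definition _ := [Choice of pert by <:].

Lemma star1 : star 1 = 1 :> A.
Proof. by rewrite -[LHS]mulr1 -[X in _ * X](starK 1) -starM mulr1 starK. Qed.

Lemma in_pert1 : in_pert 1.
Proof.
by exists [:: (1, 1)]; rewrite !big_seq1 /= star1 mulr1 tens1.
Qed.

Lemma in_pertM x y : in_pert x -> in_pert y -> in_pert (x * y).
Proof.
move=> [s [xE s1 sS]] [t [yE t1 tS]].
have big_st (W : zmodType) (F : A * A -> W) :
    \sum_(u <- [seq (p.1 * q.1, q.2 * p.2) | p <- s, q <- t]) F u =
    \sum_(p <- s) \sum_(q <- t) F (p.1 * q.1, q.2 * p.2).
  by rewrite big_allpairs_dep.
have xyE : x * y = \sum_(p <- s) \sum_(q <- t)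
    tens (p.1 * q.1) (q.2 * p.2 : A^c).
  by rewrite xE yE; exact: (sum_tensM (B := A^c) s t).
exists [seq (p.1 * q.1, q.2 * p.2) | p <- s, q <- t]; split.
- by rewrite big_st.
- rewrite big_st /= -[RHS]s1; apply: eq_bigr => p _.
  transitivity (p.1 * (\sum_(q <- t) q.1 * q.2) * p.2); last by rewrite t1 mulr1.
  by rewrite mulr_sumr mulr_suml; apply: eq_bigr => q _; rewrite !mulrA.
- rewrite !big_st /= -xyE xE yE sS tS.
  rewrite mulr_suml; apply: eq_bigr => p _.
  by rewrite mulr_sumr; apply: eq_bigr => q _; rewrite tensM !starM.
Qed.

Definition pert_mul (x y : pert) : pert :=
  Pert (asboolT (in_pertM (asboolW (valP x)) (asboolW (valP y)))).
Definition pert_one : pert := Pert (asboolT in_pert1).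

Lemma pert_mulA : associative pert_mul.
Proof. by move=> x y z; apply: val_inj; rewrite /= mulrA. Qed.
Lemma pert_mul1 : left_id pert_one pert_mul.
Proof. by move=> x; apply: val_inj; rewrite /= mul1r. Qed.
Lemma pert_mulr1 : right_id pert_one pert_mul.
Proof. by move=> x; apply: val_inj; rewrite /= mulr1. Qed.

HB.instance Definition _ := isMonoid.Build pert pert_mulA pert_mul1 pert_mulr1.

Lemma val_pertM (x y : pert) : val (x * y)%g = val x * val y.
Proof. by []. Qed.

End Pert.

Arguments pert {R} A.

Record quat (R : Type) := Quat { q_re : R; q_i : R; q_j : R; q_k : R }.

Section Quaternion.
Variable R : comNzRingType.
Local Notation H := (quat R).

Definition quat_tuple (x : H) := (q_re x, q_i x, q_j x, q_k x).
Definition tuple_quat (t : R * R * R * R) : H :=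
  Quat t.1.1.1 t.1.1.2 t.1.2 t.2.
Lemma quat_tupleK : cancel quat_tuple tuple_quat. Proof. by case. Qed.

HB.instance Definition _ := Choice.copy H (can_type quat_tupleK).

Definition quat_zero : H := Quat 0 0 0 0.
Definition quat_one : H := Quat 1 0 0 0.
Definition quat_opp (x : H) : H := Quat (- q_re x) (- q_i x) (- q_j x) (- q_k x).
Definition quat_add (x y : H) : H :=
  Quat (q_re x + q_re y) (q_i x + q_i y) (q_j x + q_j y) (q_k x + q_k y).
Definition quat_mul (x y : H) : H :=
  let: Quat a b c d := x in
  let: Quat a' b' c' d' := y in
  Quat (a * a' - b * b' - c * c' - d * d')
       (a * b' + b * a' + c * d' - d * c')
       (a * c' - b * d' + c * a' + d * b')
       (a * d' + b * c' - c * b' + d * a').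
Definition quat_scale (r : R) (x : H) : H :=
  Quat (r * q_re x) (r * q_i x) (r * q_j x) (r * q_k x).
Definition quat_conj (x : H) : H := Quat (q_re x) (- q_i x) (- q_j x) (- q_k x).

Lemma quat_addA : associative quat_add.
Proof. by move=> x y z; congr Quat; rewrite /= addrA. Qed.
Lemma quat_addC : commutative quat_add.
Proof. by move=> x y; congr Quat; rewrite addrC. Qed.
Lemma quat_add0 : left_id quat_zero quat_add.
Proof. by case=> a b c d; congr Quat; rewrite add0r. Qed.
Lemma quat_addN : left_inverse quat_zero quat_opp quat_add.
Proof. by case=> a b c d; congr Quat; rewrite addNr. Qed.

HB.instance Definition _ :=
  GRing.isZmodule.Build H quat_addA quat_addC quat_add0 quat_addN.

Lemma quat_mulA : associative quat_mul.
Proof. by case=> ? ? ? ? [? ? ? ?] [? ? ? ?]; congr Quat; ring. Qed.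
Lemma quat_mul1 : left_id quat_one quat_mul.
Proof. by case=> ? ? ? ?; congr Quat; ring. Qed.
Lemma quat_mulr1 : right_id quat_one quat_mul.
Proof. by case=> ? ? ? ?; congr Quat; ring. Qed.
Lemma quat_mulDl : left_distributive quat_mul +%R.
Proof. by case=> ? ? ? ? [? ? ? ?] [? ? ? ?]; congr Quat => /=; ring. Qed.
Lemma quat_mulDr : right_distributive quat_mul +%R.
Proof. by case=> ? ? ? ? [? ? ? ?] [? ? ? ?]; congr Quat => /=; ring. Qed.
Lemma quat_one_neq0 : quat_one != 0.
Proof. by apply/eqP => -[] /eqP; rewrite oner_eq0. Qed.

HB.instance Definition _ := GRing.Zmodule_isNzRing.Build H
  quat_mulA quat_mul1 quat_mulr1 quat_mulDl quat_mulDr quat_one_neq0.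

Lemma quat_scaleA r s x : quat_scale r (quat_scale s x) = quat_scale (r * s) x.
Proof. by congr Quat; rewrite /= mulrA. Qed.
Lemma quat_scale1 : left_id 1 quat_scale.
Proof. by case=> a b c d; congr Quat; rewrite mul1r. Qed.
Lemma quat_scaleDr : right_distributive quat_scale +%R.
Proof. by move=> r x y; congr Quat; rewrite /= mulrDr. Qed.
Lemma quat_scaleDl x : {morph quat_scale^~ x : r s / r + s}.
Proof. by move=> r s; congr Quat; rewrite /= mulrDl. Qed.

HB.instance Definition _ := GRing.Zmodule_isLmodule.Build R H
  quat_scaleA quat_scale1 quat_scaleDr quat_scaleDl.

Lemma quat_scalerAl (r : R) (x y : H) : r *: (x * y) = (r *: x) * y.
Proof. by case: x y => ? ? ? ? [? ? ? ?]; congr Quat => /=; ring. Qed.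
HB.instance Definition _ := GRing.Lmodule_isLalgebra.Build R H quat_scalerAl.

Lemma quat_scalerAr (r : R) (x y : H) : r *: (x * y) = x * (r *: y).
Proof. by case: x y => ? ? ? ? [? ? ? ?]; congr Quat => /=; ring. Qed.
HB.instance Definition _ := GRing.Lalgebra_isAlgebra.Build R H quat_scalerAr.

Lemma quat_conjK : involutive quat_conj.
Proof. by case=> a b c d; congr Quat; rewrite /= opprK. Qed.
Lemma quat_conjD : {morph quat_conj : x y / x + y}.
Proof. by move=> x y; congr Quat; rewrite /= opprD. Qed.
Lemma quat_conjZ (r : R) (x : H) : quat_conj (r *: x) = r *: quat_conj x.
Proof. by congr Quat; rewrite /= mulrN. Qed.
Lemma quat_conjM (x y : H) : quat_conj (x * y) = quat_conj y * quat_conj x.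
Proof. by case: x y => ? ? ? ? [? ? ? ?]; congr Quat => /=; ring. Qed.

HB.instance Definition _ := Algebra_isStar.Build R H
  quat_conjK quat_conjD quat_conjZ quat_conjM.

End Quaternion.

(* An alias of ['M[quat R]_n], whose own module structure is over [quat R]. *)
Definition quatmx (R : comNzRingType) (n : nat) : Type := 'M[quat R]_n.

Section QuatMatrix.
Variable R : comNzRingType.

HB.instance Definition _ n := GRing.PzRing.copy (quatmx R n) 'M[quat R]_n.
HB.instance Definition _ n := GRing.NzRing.copy (quatmx R n.+1) 'M[quat R]_n.+1.

Definition quatmx_scale n (r : R) (M : quatmx R n) : quatmx R n :=
  \matrix_(i, j) (r *: M i j).

Lemma quatmx_scaleA n r s (M : quatmx R n) :
  quatmx_scale r (quatmx_scale s M) = quatmx_scale (r * s) M.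
Proof. by apply/matrixP => i j; rewrite !mxE scalerA. Qed.
Lemma quatmx_scale1 n : left_id 1 (@quatmx_scale n).
Proof. by move=> M; apply/matrixP => i j; rewrite !mxE scale1r. Qed.
Lemma quatmx_scaleDr n : right_distributive (@quatmx_scale n) +%R.
Proof. by move=> r M P; apply/matrixP => i j; rewrite !mxE scalerDr. Qed.
Lemma quatmx_scaleDl n (M : quatmx R n) : {morph (@quatmx_scale n)^~ M : r s / r + s}.
Proof. by move=> r s; apply/matrixP => i j; rewrite !mxE scalerDl. Qed.

HB.instance Definition _ n := GRing.Zmodule_isLmodule.Build R (quatmx R n)
  (@quatmx_scaleA n) (@quatmx_scale1 n) (@quatmx_scaleDr n) (@quatmx_scaleDl n).

Lemma quatmx_scalerAl n (r : R) (M P : quatmx R n.+1) :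
  r *: (M * P) = (r *: M) * P.
Proof.
apply/matrixP => i j; rewrite !mxE scaler_sumr.
by apply: eq_bigr => k _; rewrite mxE scalerAl.
Qed.
HB.instance Definition _ n :=
  GRing.Lmodule_isLalgebra.Build R (quatmx R n.+1) (@quatmx_scalerAl n).

Lemma quatmx_scalerAr n (r : R) (M P : quatmx R n.+1) :
  r *: (M * P) = M * (r *: P).
Proof.
apply/matrixP => i j; rewrite !mxE scaler_sumr.
by apply: eq_bigr => k _; rewrite mxE scalerAr.
Qed.
HB.instance Definition _ n :=
  GRing.Lalgebra_isAlgebra.Build R (quatmx R n.+1) (@quatmx_scalerAr n).

Definition quatmx_star n (M : quatmx R n) : quatmx R n :=
  \matrix_(i, j) quat_conj (M j i).

Lemma quatmx_starK n : involutive (@quatmx_star n).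
Proof. by move=> M; apply/matrixP => i j; rewrite !mxE quat_conjK. Qed.
Lemma quatmx_starD n : {morph @quatmx_star n : x y / x + y}.
Proof. by move=> M P; apply/matrixP => i j; rewrite !mxE quat_conjD. Qed.
Lemma quatmx_starZ n (r : R) (M : quatmx R n) :
  quatmx_star (r *: M) = r *: quatmx_star M.
Proof. by apply/matrixP => i j; rewrite !mxE quat_conjZ. Qed.
Lemma quatmx_starM n (M P : quatmx R n) :
  quatmx_star (M * P) = quatmx_star P * quatmx_star M.
Proof.
apply/matrixP => i j; rewrite !mxE.
rewrite (big_morph _ (@quat_conjD R) (_ : quat_conj 0 = 0)); last first.
  by congr Quat; rewrite /= oppr0.
by apply: eq_bigr => k _; rewrite !mxE quat_conjM.
Qed.

HB.instance Definition _ n := Algebra_isStar.Build R (quatmx R n.+1)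
  (@quatmx_starK n.+1) (@quatmx_starD n.+1) (@quatmx_starZ n.+1) (@quatmx_starM n.+1).

End QuatMatrix.

(* For a matrix P with +1 and -1 on the diagonal, [twisted_vec P] is the set of
   rows v with conj v = v P and [twisted_mx P] the semigroup of matrices B with
   P conj(B) = B P.  At P = Psi' these are V and S and [semidirect P] is V ⋊ S;
   at P = Theta', [twisted_mx P] is T. *)
Section TwistedReal.
Variables (R : rcfType) (m : nat) (P : 'M[R[i]]_m).

Definition twisted_rV : {pred 'rV[R[i]]_m} :=
  fun v => map_mx conjc v == v *m P.

Record twisted_vec := TwistedVec { tvec_val :> 'rV[R[i]]_m; _ : tvec_val \in twisted_rV }.
HB.instance Definition _ := [isSub for tvec_val].
HB.instance Definition _ := [Choice of twisted_vec by <:].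

Lemma twisted_rV_zmod : zmod_closed twisted_rV.
Proof.
split=> [|u v]; rewrite !unfold_in; first by rewrite map_mx0 mul0mx.
by move=> /eqP uE /eqP vE; rewrite map_mxB uE vE mulmxBl.
Qed.
HB.instance Definition _ := GRing.isZmodClosed.Build _ twisted_rV twisted_rV_zmod.
HB.instance Definition _ := [SubChoice_isSubZmodule of twisted_vec by <:].

Definition twisted_M : {pred 'M[R[i]]_m} :=
  fun B => P *m map_mx conjc B == B *m P.

Record twisted_mx := TwistedMx { tmx_val :> 'M[R[i]]_m; _ : tmx_val \in twisted_M }.
HB.instance Definition _ := [isSub for tmx_val].
HB.instance Definition _ := [Choice of twisted_mx by <:].

Lemma twisted_M1 : 1%:M \in twisted_M.
Proof. by rewrite unfold_in map_mx1 mulmx1 mul1mx. Qed.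

Lemma twisted_MM (B C : twisted_mx) : B *m C \in twisted_M.
Proof.
have /eqP BE := valP B; have /eqP CE := valP C; rewrite /= in BE CE.
by rewrite unfold_in map_mxM mulmxA BE -mulmxA CE mulmxA.
Qed.

Definition tmx_mul (B C : twisted_mx) : twisted_mx := TwistedMx (twisted_MM B C).
Definition tmx_one : twisted_mx := TwistedMx twisted_M1.

Lemma tmx_mulA : associative tmx_mul.
Proof. by move=> B C D; apply: val_inj; rewrite /= mulmxA. Qed.
Lemma tmx_mul1 : left_id tmx_one tmx_mul.
Proof. by move=> B; apply: val_inj; rewrite /= mul1mx. Qed.
Lemma tmx_mulr1 : right_id tmx_one tmx_mul.
Proof. by move=> B; apply: val_inj; rewrite /= mulmx1. Qed.

HB.instance Definition _ := isMonoid.Build twisted_mx tmx_mulA tmx_mul1 tmx_mulr1.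

Lemma twisted_act (v : twisted_vec) (B : twisted_mx) : v *m B \in twisted_rV.
Proof.
have /eqP vE := valP v; have /eqP BE := valP B; rewrite /= in vE BE.
by rewrite unfold_in map_mxM vE -mulmxA BE mulmxA.
Qed.

Definition tvec_act (v : twisted_vec) (B : twisted_mx) : twisted_vec :=
  TwistedVec (twisted_act v B).

(* The alias keeps the direct product structure of pairs out of the way. *)
Definition semidirect : Type := (twisted_vec * twisted_mx)%type.
HB.instance Definition _ := Choice.on semidirect.

Definition sd_mul (x y : semidirect) : semidirect :=
  (y.1 + tvec_act x.1 y.2, (x.2 * y.2)%g).
Definition sd_one : semidirect := (0, 1%g).

Lemma tvec_actM v B C : tvec_act v (B * C)%g = tvec_act (tvec_act v B) C.
Proof. by apply: val_inj; rewrite /= mulmxA. Qed.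
Lemma tvec_actD u v B : tvec_act (u + v) B = tvec_act u B + tvec_act v B.
Proof. by apply: val_inj; rewrite /= mulmxDl. Qed.
Lemma tvec_act0 B : tvec_act 0 B = 0.
Proof. by apply: val_inj; rewrite /= mul0mx. Qed.
Lemma tvec_act1 v : tvec_act v 1%g = v.
Proof. by apply: val_inj; rewrite /= mulmx1. Qed.

Lemma sd_mulA : associative sd_mul.
Proof.
move=> x y z; congr pair => /=; last by rewrite mulgA.
by rewrite tvec_actM tvec_actD addrA.
Qed.
Lemma sd_mul1 : left_id sd_one sd_mul.
Proof. by case=> v B; congr pair; rewrite /= ?tvec_act0 ?addr0 ?mul1g. Qed.
Lemma sd_mulr1 : right_id sd_one sd_mul.
Proof. by case=> v B; congr pair; rewrite /= ?tvec_act1 ?add0r ?mulg1. Qed.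

HB.instance Definition _ := isMonoid.Build semidirect sd_mulA sd_mul1 sd_mulr1.

End TwistedReal.

Section Signatures.
Variables (R : rcfType) (N : nat).

Lemma Psi'_dim : (N ^ 2 - 1 + N * (N - 1) = (2 * N + 1) * (N - 1))%N.
Proof. by rewrite -mulnn; case: N => [|n]; nia. Qed.

Lemma Theta'_dim : (N ^ 2 + N * (N + 1) = N * (2 * N + 1))%N.
Proof. by rewrite -mulnn; lia. Qed.

Definition Psi' : 'M[R[i]]_((2 * N + 1) * (N - 1)) :=
  castmx (Psi'_dim, Psi'_dim)
    (block_mx (1%:M : 'M_(N ^ 2 - 1)) 0 0 (- 1%:M : 'M_(N * (N - 1)))).

Definition Theta' : 'M[R[i]]_(N * (2 * N + 1)) :=
  castmx (Theta'_dim, Theta'_dim)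
    (block_mx (1%:M : 'M_(N ^ 2)) 0 0 (- 1%:M : 'M_(N * (N + 1)))).

End Signatures.

(* Main.v *)
(* Every element t of the tensor product of A = M_N(H) with its opposite acts on
   A by a ⊗ b° : y ↦ a y b.  This action is multiplicative, and it is onto the
   real endomorphisms of A because y ↦ (Re y_ij) q E_kl is the action of
   1/4 Σ_r q r E_ki ⊗ (r* E_jl)°, with r running over 1, i, j, k; comparing
   dimensions, it is also injective.  An element is in Pert(A) if and only if its
   action fixes 1 and commutes with the involution, that is, preserves the
   Hermitian part (of dimension N(2N-1), containing 1) and the skew-Hermitian
   part (of dimension N(2N+1)).  In an adapted basis that starts with 1 these are
   the matrices with diagonal blocks [[1, v], [0, B]] and C, whose product is
   that of (V ⋊ S) × T for real v, B and C.  Conjugation by the diagonal matrix of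
   the square roots 1 and i of the signature replaces real matrices with the
   twisted ones. *)
From HB Require Import structures.
Require Import Defs.
From mathcomp Require Import all_boot all_order all_algebra.
From mathcomp Require Import reals complex.
From mathcomp Require Import boolp ring zify.

Set Implicit Arguments.
Unset Strict Implicit.
Unset Printing Implicit Defensive.

Import GRing.Theory Num.Theory.
Local Open Scope ring_scope.

(** * The action of [A] ⊗ [A^c] on [A] by multiplication on both sides *)

Section Action.
Variables (F : comNzRingType) (A : algType F).
Implicit Types (t : tensor A A^c) (x y : A).

Definition act t y : A := tens_lift (fun (a : A) (b : A^c) => a * y * (b : A)) t.

Lemma act_sum (s : seq (A * A)) y :
  act (\sum_(p <- s) tens p.1 (p.2 : A^c)) y = \sum_(p <- s) p.1 * y * p.2.
Proof.
rewrite /act (@tens_liftE F A A^c A (fun a b => a * y * (b : A))) //.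
- by move=> a a' b; rewrite !mulrDl.
- by move=> a b b'; rewrite mulrDr.
- by move=> r a b; rewrite -!scalerAl -scalerAr.
Qed.

Lemma act_tens (a b : A) y : act (tens a (b : A^c)) y = a * y * b.
Proof. by have := act_sum [:: (a, b)] y; rewrite !big_seq1. Qed.

Lemma tensor_sum t : exists s : seq (A * A), t = \sum_(p <- s) tens p.1 (p.2 : A^c).
Proof. by exists (tens_repr t); exact: (tensorE t). Qed.

Lemma actDl t t' y : act (t + t') y = act t y + act t' y.
Proof.
have [[s ->] [s' ->]] := (tensor_sum t, tensor_sum t').
by rewrite -big_cat !act_sum big_cat.
Qed.

Lemma actZl r t y : act (r *: t) y = r *: act t y.
Proof.
have [s ->] := tensor_sum t; rewrite act_sum !scaler_sumr.
have -> : \sum_(p <- s) r *: tens p.1 (p.2 : A^c) =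
    \sum_(p <- [seq (r *: p.1, p.2) | p <- s]) tens p.1 (p.2 : A^c).
  by rewrite big_map; apply: eq_bigr => p _; rewrite -tensZl.
by rewrite act_sum big_map; apply: eq_bigr => p _; rewrite -!scalerAl.
Qed.

Lemma act0l y : act 0 y = 0.
Proof. by apply: (addrI (act 0 y)); rewrite -actDl !addr0. Qed.

Lemma act_suml I (s : seq I) (P : pred I) (G : I -> tensor A A^c) y :
  act (\sum_(i <- s | P i) G i) y = \sum_(i <- s | P i) act (G i) y.
Proof. by apply: (big_morph (act^~ y)) => [t t'|]; rewrite ?actDl ?act0l. Qed.

Lemma act_linear t : linear (act t).
Proof.
move=> r x y; have [s ->] := tensor_sum t; rewrite !act_sum scaler_sumr -big_split.
by apply: eq_bigr => p _; rewrite mulrDr mulrDl -scalerAr -scalerAl.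
Qed.

HB.instance Definition _ t :=
  GRing.isLinear.Build F A A _ (act t) (act_linear t).

(** The reversed product of [A^c] makes the right factors compose in the correct order: a (a' y b')
    b = (a a') y (b' b). *)
Lemma actM t t' y : act (t * t') y = act t (act t' y).
Proof.
have [[s ->] [s' ->]] := (tensor_sum t, tensor_sum t').
rewrite (@sum_tensM F A A^c s s') act_suml act_sum; apply: eq_bigr => p _.
rewrite act_suml act_sum mulr_sumr mulr_suml; apply: eq_bigr => q _.
rewrite (act_tens (p.1 * q.1) ((p.2 : A^c) * q.2)).
by rewrite !mulrA.
Qed.

End Action.

(** * Endomorphisms as matrices, and injectivity of the action *)

Section Coordinates.
Variables (F : fieldType) (A : algType F) (d : nat).
Variables (k : {linear A -> 'cV[F]_d}) (k' : {linear 'cV[F]_d -> A}).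
Hypotheses (kK : cancel k k') (k'K : cancel k' k).

Let e (i : 'I_d) : A := k' (delta_mx i 0).

Lemma coord_basis a : a = \sum_i k a i 0 *: e i.
Proof.
rewrite -{1}(kK a) [in LHS](matrix_sum_delta (k a)) linear_sum.
by apply: eq_bigr => i _; rewrite big_ord1 linearZ.
Qed.

Definition coord_mx (f : A -> A) : 'M[F]_d := \matrix_(i, j) k (f (e j)) i 0.

Lemma coord_mxE (f : {linear A -> A}) a : coord_mx f *m k a = k (f a).
Proof.
apply/colP => i; rewrite [in RHS](coord_basis a) !linear_sum summxE mxE.
by apply: eq_bigr => j _; rewrite !linearZ !mxE mulrC.
Qed.

Definition mx_coord (M : 'M[F]_d) (a : A) : A := k' (M *m k a).

Lemma mx_coord_linear M : linear (mx_coord M).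
Proof. by move=> r x y; rewrite /mx_coord !linearP. Qed.
HB.instance Definition _ M :=
  GRing.isLinear.Build F A A _ (mx_coord M) (mx_coord_linear M).

Lemma mx_coordK M : coord_mx (mx_coord M) = M.
Proof.
apply/matrixP => i j; rewrite mxE /mx_coord !k'K -colE.
by rewrite mxE.
Qed.

Lemma coord_mx_inj (f g : {linear A -> A}) : coord_mx f = coord_mx g -> f =1 g.
Proof. by move=> fg a; apply: (can_inj kK); rewrite -!coord_mxE fg. Qed.

Hypothesis act_surj : forall f : {linear A -> A}, exists t, act t =1 f.

(** Every tensor is a combination of products of basis elements ([G_surj]). Indexing these
    combinations by matrices makes [H] below a linear endomorphism of ['M[F]_d], to which rank and
    nullity apply without the dimension of the tensor product being known. *)
Let G (C : 'M[F]_d) : tensor A A^c := \sum_i \sum_j C i j *: tens (e i) (e j : A^c).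

Let G_surj t : exists C, t = G C.
Proof.
have [s ->] := tensor_sum t.
exists (\sum_(p <- s) \matrix_(i, j) (k p.1 i 0 * k p.2 j 0)).
rewrite /G; under [RHS]eq_bigr do under eq_bigr do rewrite summxE scaler_suml.
under [RHS]eq_bigr do rewrite exchange_big.
rewrite exchange_big; apply: eq_bigr => p _ /=.
rewrite {1}(coord_basis p.1) {1}(coord_basis p.2).
rewrite (big_morph _ (fun a a' => tensDl a a' _) (tens0l _ _)).
apply: eq_bigr => i _.
rewrite (big_morph _ (fun b b' => tensDr (_ : A) (b : A^c) b') (tens0r _ _)).
apply: eq_bigr => j _.
by rewrite mxE -scalerA -(tensZr (B := A^c)) -tensZl.
Qed.

Let H (C : 'M[F]_d) : 'M[F]_d := coord_mx (act (G C)).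

Let H_linear : linear H.
Proof.
move=> r C D; apply/matrixP => i j; rewrite !mxE.
have -> : G (r *: C + D) = r *: G C + G D.
  rewrite /G scaler_sumr -big_split; apply: eq_bigr => u _ /=.
  rewrite scaler_sumr -big_split; apply: eq_bigr => w _ /=.
  by rewrite !mxE scalerDl scalerA.
by rewrite actDl actZl linearP !mxE.
Qed.
HB.instance Definition _ := GRing.isLinear.Build F _ _ _ H H_linear.

(* [tensor A A^c] is spanned by [d ^ 2] elements and the endomorphisms of [A]
   have dimension [d ^ 2], so that surjectivity forces injectivity. *)
Lemma act_inj (t t' : tensor A A^c) : act t =1 act t' -> t = t'.
Proof.
have [[C ->] [D ->]] := (G_surj t, G_surj t') => CD.
have H_full : limg (linfun H) = fullv.
  apply/eqP; rewrite eqEsubv subvf /=; apply/subvP => M _.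
  have [u uM] := act_surj (mx_coord M); have [E uE] := G_surj u.
  suff -> : M = linfun H E by rewrite memv_img ?memvf.
  rewrite lfunE /= /H -uE -[LHS]mx_coordK.
  by apply/matrixP => i j; rewrite !mxE uM.
have : lker (linfun H) == 0%VS.
  rewrite -dimv_eq0; have := limg_ker_dim (linfun H) fullv.
  by rewrite H_full capfv => /eqP; rewrite -[X in _ == X]add0n eqn_add2r.
move=> /lker0P Hinj; congr G; apply: Hinj; rewrite !lfunE /= /H.
by apply/matrixP => i j; rewrite !mxE CD.
Qed.

End Coordinates.

(** * Surjectivity of the action for quaternionic matrices *)

Section QuatMatrixEndomorphisms.
Variables (F : numFieldType) (n : nat).
Local Notation A := (quatmx F n.+1).
Implicit Types (c : quat F) (x y : A) (i j : 'I_n.+1).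

Definition quat_units : seq (quat F) :=
  [:: Quat 1 0 0 0; Quat 0 1 0 0; Quat 0 0 1 0; Quat 0 0 0 1].

(** The four units are orthonormal for the form Re(x conj(y)). *)
Lemma quat_unitsE c : c = \sum_(p <- quat_units) q_re (c * quat_conj p) *: p.
Proof.
by case: c => a b c d; rewrite !big_cons big_nil; congr Quat => /=; ring.
Qed.

(** An imaginary unit is fixed under conjugation by 1 and by itself and negated by the other two, so
    that its contributions cancel. This is how left and right multiplications isolate a real
    part. *)
Lemma sum_quat_conj c :
  \sum_(p <- quat_units) p * c * quat_conj p = (4%:R * q_re c) *: 1.
Proof.
by case: c => a b c d; rewrite !big_cons big_nil; congr Quat => /=; ring.
Qed.

Definition quat_delta c i j : A := \matrix_(a, b) (c *+ ((a == i) && (b == j))).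

Lemma quat_deltaD i j : {morph (fun c => quat_delta c i j) : c c' / c + c'}.
Proof. by move=> c c'; apply/matrixP => a b; rewrite !mxE mulrnDl. Qed.

Lemma quat_delta0 i j : quat_delta 0 i j = 0.
Proof. by apply/matrixP => a b; rewrite !mxE mul0rn. Qed.

Lemma quat_deltaZ i j r c : quat_delta (r *: c) i j = r *: quat_delta c i j.
Proof. by apply/matrixP => a b; rewrite !mxE scalerMnr. Qed.

Lemma quat_delta_sum x : x = \sum_i \sum_j quat_delta (x i j) i j.
Proof.
apply/matrixP => a b; rewrite summxE (bigD1 a) //= summxE (bigD1 b) //=.
rewrite !mxE !eqxx big1 => [|j /negbTE bj]; last first.
  by rewrite mxE eqxx eq_sym bj mulr0n.
rewrite big1 ?addr0 // => i /negbTE ai; rewrite summxE big1 // => j _.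
by rewrite mxE eq_sym ai mulr0n.
Qed.

Lemma quat_deltaM c c' k i j l y :
  quat_delta c k i * y * quat_delta c' j l = quat_delta (c * y i j * c') k l.
Proof.
apply/matrixP => a b; rewrite !mxE (bigD1 j) //= !mxE [X in _ + X]big1 ?addr0; last first.
  by move=> s /negbTE-sj; rewrite !mxE sj mulr0n mulr0.
rewrite (bigD1 i) //= !mxE [X in (_ + X) * _]big1 ?addr0; last first.
  by move=> s /negbTE-si; rewrite !mxE si andbF mulr0n mul0r.
rewrite !eqxx andbT /=.
by case: (a == k); case: (b == l); rewrite /= ?mulr1n ?mulr0n ?(mul0r, mulr0).
Qed.

Lemma quatmx_act_surj (f : {linear A -> A}) : exists t, act t =1 f.
Proof.
(* For fixed i, j, p, k, l the sum over r acts by y ↦ Re(y_ij conj(p)) c E_kl, where c is the entry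
   (k, l) of f(p E_ij); the factor 1/4 cancels the 4 of [sum_quat_conj]. The other sums rebuild f(y)
   by linearity. *)
exists (\sum_i \sum_j \sum_(p <- quat_units) \sum_k \sum_l \sum_(r <- quat_units)
  tens (4%:R^-1 *: quat_delta (f (quat_delta p i j) k l * r) k i)
       (quat_delta (quat_conj p * quat_conj r) j l : A^c)) => y.
rewrite [in RHS](quat_delta_sum y) linear_sum act_suml; apply: eq_bigr => i _.
rewrite linear_sum act_suml; apply: eq_bigr => j _.
rewrite [in RHS](quat_unitsE (y i j)) (big_morph _ (@quat_deltaD _ _) (quat_delta0 _ _)).
rewrite linear_sum act_suml; apply: eq_bigr => p _.
rewrite quat_deltaZ linearZ /= [in RHS](quat_delta_sum (f _)) scaler_sumr act_suml.
apply: eq_bigr => k _; rewrite scaler_sumr act_suml; apply: eq_bigr => l _.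
rewrite act_suml -quat_deltaZ; set c := f _ k l.
transitivity (\sum_(r <- quat_units) quat_delta
    (4%:R^-1 *: (c * (r * (y i j * quat_conj p) * quat_conj r))) k l).
  apply: eq_bigr => r _; rewrite act_tens -!scalerAl quat_deltaM quat_deltaZ.
  by rewrite !mulrA.
rewrite -(big_morph _ (@quat_deltaD _ _) (quat_delta0 _ _)) -scaler_sumr.
rewrite -mulr_sumr sum_quat_conj -scalerAr mulr1 scalerA mulrA mulVf ?mul1r //.
by rewrite pnatr_eq0.
Qed.

End QuatMatrixEndomorphisms.

(** This will number the coordinates with that of 1 first, then the other Hermitian ones, then the
    skew-Hermitian ones, so that the matrices of interest become block matrices. *)
Lemma ordered_enum (I : finType) (o : I) (P : pred I) (m k : nat) :
  P o -> #|P| = m.+1 -> #|predC P| = k ->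
  exists e : 'I_(1 + (m + k)) -> I,
    [/\ bijective e, e ord0 = o & forall i, P (e i) = (i < m.+1)%N].
Proof.
move=> Po cP cP'; pose s := o :: enum (predD1 P o) ++ enum (predC P).
have s1 : size (enum (predD1 P o)) = m.
  by rewrite -cardE; apply: succn_inj; rewrite -cP (cardD1 o P) [o \in P]Po.
have s2 : size (enum (predC P)) = k by rewrite -cardE.
have sz : size s = (1 + (m + k))%N by rewrite /= size_cat s1 s2.
have s_uniq : uniq s.
  rewrite /= cat_uniq !enum_uniq mem_cat !mem_enum !inE eqxx Po /= andbT.
  by apply/hasPn => x; rewrite !mem_enum !inE => /negbTE ->; rewrite andbF.
exists (fun i => nth o s i); split=> // [|i].
  apply: inj_card_bij => [i j /eqP|].
    by rewrite nth_uniq ?sz // => /eqP /val_inj.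
  by rewrite card_ord -(cardC P) cP cP'.
case: i => -[|i] /= lti; first by rewrite Po.
rewrite nth_cat s1 [RHS]ltnS; case: ltnP => im.
  have : nth o (enum (predD1 P o)) i \in enum (predD1 P o) by rewrite mem_nth ?s1.
  by rewrite mem_enum !inE => /andP[].
have : nth o (enum (predC P)) (i - m) \in enum (predC P).
  by rewrite mem_nth ?s2 //; lia.
by rewrite mem_enum inE => /negbTE.
Qed.

(** * Coordinates on M_N(H) adapted to the involution, and their count *)

Section QuatMatrixCoordinates.
Variables (F : numFieldType) (n : nat).
Local Notation A := (quatmx F n.+1).
Local Notation I := ('I_4 * 'I_n.+1 * 'I_n.+1)%type.

Definition quat_coef (q : quat F) (c : 'I_4) : F :=
  [:: q_re q; q_i q; q_j q; q_k q]`_c.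

Lemma quat_coefP (q q' : quat F) : quat_coef q =1 quat_coef q' -> q = q'.
Proof.
case: q q' => a b c d [a' b' c' d'] qq'.
congr Quat; [exact: (qq' ord0) | exact: (qq' (@Ordinal 4 1 isT))
  | exact: (qq' (@Ordinal 4 2 isT)) | exact: (qq' (@Ordinal 4 3 isT))].
Qed.

Lemma quat_coef_linear c : linear (quat_coef^~ c : quat F -> F^o).
Proof. by move=> r [? ? ? ?] [? ? ? ?]; case: c => -[|[|[|[|]]]]. Qed.

Lemma quat_coef_conj q c :
  quat_coef (quat_conj q) c = if c == 0 then quat_coef q c else - quat_coef q c.
Proof. by case: c => -[|[|[|[|]]]]. Qed.

Lemma quat_coef1 c : quat_coef 1 c = (c == 0)%:R.
Proof. by case: c => -[|[|[|[|]]]]. Qed.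

(* [star] acts on each coordinate by the sign that [quat_index_sym] gives, and
   [1] has the single nonzero coordinate [(0, 0, 0)]; the latter is the reason
   for subtracting the corner entry on the rest of the real diagonal. *)
Definition quat_coord (x : A) (a : I) : F :=
  let: (c, i, j) := a in
  if i == j then
    quat_coef (x i j) c - (quat_coef (x 0 0) 0 *+ ((c == 0) && (i != 0)))
  else if (i < j)%N then quat_coef (x i j) c + quat_coef (x j i) c
  else quat_coef (x i j) c - quat_coef (x j i) c.

(** True at the coordinates that [star] fixes: conjugation negates the imaginary components,
    transposition negates the differences stored below the diagonal, and the two signs multiply. *)
Definition quat_index_sym (a : I) : bool := (a.1.1 == 0) == (a.1.2 <= a.2)%N.

(** Two mirror entries are recovered from their sum, stored above the diagonal, and their
    difference, stored below it; hence the halves. On the diagonal, the corner entry is added back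
    to the real parts. *)
Definition quat_uncoord (y : I -> F) : A :=
  let entry i j c :=
    if i == j then y (c, i, j) + (y (0, 0, 0) *+ ((c == 0) && (i != 0)))
    else if (i < j)%N then (y (c, i, j) - y (c, j, i)) / 2%:R
    else (y (c, j, i) + y (c, i, j)) / 2%:R in
  \matrix_(i, j) Quat (entry i j 0) (entry i j (@Ordinal 4 1 isT))
    (entry i j (@Ordinal 4 2 isT)) (entry i j (@Ordinal 4 3 isT)).

Lemma quat_uncoordE y i j c : quat_coef (quat_uncoord y i j) c =
    if i == j then y (c, i, j) + (y (0, 0, 0) *+ ((c == 0) && (i != 0)))
    else if (i < j)%N then (y (c, i, j) - y (c, j, i)) / 2%:R
    else (y (c, j, i) + y (c, i, j)) / 2%:R.
Proof.
rewrite mxE; case: c => -[|[|[|[|//]]]] c4 /=; rewrite /quat_coef /=.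
- by rewrite (_ : Ordinal c4 = 0) //; apply: val_inj.
- by rewrite (_ : Ordinal c4 = @Ordinal 4 1 isT) //; apply: val_inj.
- by rewrite (_ : Ordinal c4 = @Ordinal 4 2 isT) //; apply: val_inj.
- by rewrite (_ : Ordinal c4 = @Ordinal 4 3 isT) //; apply: val_inj.
Qed.

Lemma quat_coordK x : quat_uncoord (quat_coord x) = x.
Proof.
apply/matrixP => i j; apply: quat_coefP => c; rewrite quat_uncoordE /quat_coord.
have two : 2%:R != 0 :> F by rewrite pnatr_eq0.
case: (ltngtP i j) => [ij|ij|/val_inj <-].
- by rewrite -!val_eqE /= (gtn_eqF ij) (ltn_eqF ij); field.
- by rewrite -!val_eqE /= (gtn_eqF ij) (ltn_eqF ij); field.
- by rewrite !eqxx mulr0n subr0 subrK.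
Qed.

Lemma quat_uncoordK y : quat_coord (quat_uncoord y) =1 y.
Proof.
case=> -[c i] j; rewrite /quat_coord !quat_uncoordE.
have two : 2%:R != 0 :> F by rewrite pnatr_eq0.
case: (ltngtP i j) => [ij|ij|/val_inj <-].
- by rewrite -!val_eqE /= (gtn_eqF ij) (ltn_eqF ij); field.
- by rewrite -!val_eqE /= (gtn_eqF ij) (ltn_eqF ij); field.
- by rewrite !eqxx mulr0n addr0 addrK.
Qed.

Lemma quat_coordP r x y a :
  quat_coord (r *: x + y) a = r * quat_coord x a + quat_coord y a.
Proof.
have E i j c : quat_coef ((r *: x + y) i j) c =
    r * quat_coef (x i j) c + quat_coef (y i j) c.
  by rewrite !mxE [LHS]quat_coef_linear.
case: a => -[c i] j; rewrite /quat_coord !E.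
by case: eqP => _; [case: (_ && _) | case: (_ < _)%N]; rewrite ?mulr0n; ring.
Qed.

Lemma quat_coord1 a : quat_coord 1 a = (a == 0)%:R.
Proof.
have E i j c : quat_coef ((1 : A) i j) c = ((c == 0) && (i == j))%:R.
  by rewrite mxE; case: (i == j); rewrite ?quat_coef1 ?andbT ?andbF //;
    case: c => -[|[|[|[|]]]].
case: a => -[c i] j; rewrite /quat_coord !E !xpair_eqE.
case: (altP (i =P j)) => [<-|ij].
  by case: (c == 0); case: (i == 0); rewrite /= ?eqxx ?subrr ?subr0 ?mulr0n ?mulr1n ?subrr ?subr0.
rewrite eq_sym [j == i]eq_sym (negbTE ij) !andbF addr0 subr0 if_same.
move: ij; case: (altP (i =P 0)) => [->|_ _]; last by rewrite andbF.
by rewrite eq_sym => /negbTE ->; rewrite andbF.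
Qed.

Lemma quat_coord_star x a :
  quat_coord (star x) a = if quat_index_sym a then quat_coord x a else - quat_coord x a.
Proof.
have E i j c : quat_coef ((star x : A) i j) c =
    if c == 0 then quat_coef (x j i) c else - quat_coef (x j i) c.
  by rewrite mxE quat_coef_conj.
case: a => -[c i] j; rewrite /quat_coord /quat_index_sym !E /=.
case: (ltngtP i j) => [ij|ij|/val_inj <-].
- rewrite -!val_eqE /= (ltn_eqF ij) ; case: (val c == 0%N) => /=; ring.
- rewrite -!val_eqE /= (gtn_eqF ij) ; case: (val c == 0%N) => /=; ring.
- rewrite eqxx; case: (c == 0) => /=; rewrite ?mulr0n; ring.
Qed.

(** Exchanging i and j shows that twice the strict upper triangle counts the pairs with i ≠ j; the
    diagonal supplies the remaining N. *)
Lemma sum_ltn_ord N : ((\sum_(i < N) \sum_(j < N) (i < j)).*2 + N = N * N)%N.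
Proof.
rewrite -addnn {2}exchange_big /= -big_split /=.
rewrite -[X in (_ + X)%N]card_ord -sum1_card -big_split /=.
transitivity (\sum_(i < N) N)%N; last by rewrite sum_nat_const card_ord.
apply: eq_bigr => i _.
rewrite -big_split /= -[RHS]card_ord -sum1_card [LHS]addnC.
rewrite (bigD1 i) //= [in RHS](bigD1 i) //= ltnn !add0n; congr addn.
by apply: eq_bigr => j; rewrite -val_eqE /=; case: ltngtP.
Qed.

(** The real component contributes the N^2 - T pairs with i ≤ j, and each of the three imaginary
    ones the T pairs with j < i. Since 2T + N = N^2, the total is 2N^2 - N. *)
Lemma card_quat_index_sym : #|quat_index_sym| = ((2 * n.+1 + 1) * (n.+1 - 1)).+1.
Proof.
pose T := (\sum_(i < n.+1) \sum_(j < n.+1) (i < j))%N.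
have TE : (T.*2 + n.+1 = n.+1 * n.+1)%N := sum_ltn_ord n.+1.
have T' : (\sum_(i < n.+1) \sum_(j < n.+1) ~~ (i <= j) = T)%N.
  by rewrite /T exchange_big; apply: eq_bigr => i _; apply: eq_bigr => j _; rewrite ltnNge.
have T0 : (\sum_(i < n.+1) \sum_(j < n.+1) (i <= j) + T = n.+1 * n.+1)%N.
  rewrite -T' -big_split.
  transitivity (\sum_(i < n.+1) n.+1)%N; last by rewrite sum_nat_const card_ord.
  apply: eq_bigr => i _; rewrite -big_split /= -[RHS]card_ord -sum1_card.
  by apply: eq_bigr => j _; case: leqP.
have -> : #|quat_index_sym| =
    (\sum_(c < 4) \sum_(i < n.+1) \sum_(j < n.+1) ((c == 0%R) == (i <= j)))%N.
  rewrite -sum1_card big_mkcond /= pair_bigA pair_bigA /=.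
  by apply: eq_bigr => -[[c i] j] _; rewrite unfold_in /quat_index_sym /=; case: (_ == _).
rewrite big_ord_recl [X in (_ + X)%N](eq_bigr (fun _ => T)) => [|c _]; last first.
  by rewrite -T'; apply: eq_bigr => i _; apply: eq_bigr => j _; rewrite eq_sym eqbF_neg.
rewrite sum_nat_const card_ord; set S := (X in (X + _)%N).
have -> : S = (\sum_(i < n.+1) \sum_(j < n.+1) (i <= j))%N.
  by apply: eq_bigr => i _; apply: eq_bigr => j _; rewrite eq_sym eqb_id.
by rewrite subn1; nia.
Qed.

Lemma card_quat_index_skew : #|predC quat_index_sym| = (n.+1 * (2 * n.+1 + 1))%N.
Proof.
have := cardC quat_index_sym; rewrite card_quat_index_sym !card_prod !card_ord.
by set z := #|_|; lia.
Qed.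

End QuatMatrixCoordinates.

(** * The resulting linear isomorphism with column vectors *)

Section QuatMatrixColumns.
Variables (F : numFieldType) (n d : nat).
Local Notation A := (quatmx F n.+1).
Local Notation I := ('I_4 * 'I_n.+1 * 'I_n.+1)%type.
Variables (e : 'I_d -> I) (e' : I -> 'I_d).
Hypotheses (eK : cancel e e') (e'K : cancel e' e).

Definition quat_col (x : A) : 'cV[F]_d := \col_i quat_coord x (e i).
Definition quat_uncol (w : 'cV[F]_d) : A := quat_uncoord (fun a => w (e' a) 0).

Lemma quat_col_linear : linear quat_col.
Proof. by move=> r x y; apply/colP => i; rewrite !mxE quat_coordP. Qed.
HB.instance Definition _ := GRing.isLinear.Build F A _ _ quat_col quat_col_linear.

Lemma quat_colK : cancel quat_col quat_uncol.
Proof.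
move=> x; rewrite -[RHS]quat_coordK; congr quat_uncoord.
by apply/funext => a; rewrite mxE e'K.
Qed.

Lemma quat_uncolK : cancel quat_uncol quat_col.
Proof. by move=> w; apply/colP => i; rewrite mxE quat_uncoordK eK. Qed.

Lemma quat_uncol_linear : linear quat_uncol.
Proof. exact: can2_linear quat_colK quat_uncolK. Qed.

End QuatMatrixColumns.

Lemma quatmx_coordinates (F : numFieldType) (n : nat) :
  let A := quatmx F n.+1 in
  let m := ((2 * n.+1 + 1) * (n.+1 - 1))%N in
  let l := (n.+1 * (2 * n.+1 + 1))%N in
  exists (k : {linear A -> 'cV[F]_(1 + (m + l))})
         (k' : {linear 'cV[F]_(1 + (m + l)) -> A}),
    [/\ cancel k k', cancel k' k, k 1 = delta_mx 0 0 &
        forall x i, k (star x) i 0 = if (i < m.+1)%N then k x i 0 else - k x i 0].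
Proof.
move=> A m l.
have [e [[e' eK e'K] e0 eP]] := ordered_enum (I := ('I_4 * 'I_n.+1 * 'I_n.+1)%type) (o := 0) (P := @quat_index_sym n)
  isT (@card_quat_index_sym n) (@card_quat_index_skew n).
(* Linearity of [quat_uncol] depends on [eK] and [e'K], so that its structure is packed by hand. *)
pose k' : {linear 'cV[F]_(1 + (m + l)) -> A} := HB.pack (quat_uncol (F := F) e')
  (GRing.isLinear.Build _ _ _ _ _ (quat_uncol_linear (F := F) eK e'K)).
exists (quat_col e), k'; split.
- exact: (quat_colK e'K).
- exact: (quat_uncolK eK).
- apply/colP => i; rewrite !mxE quat_coord1 -e0 (can_eq eK) andbT.
  by congr ((_ == _)%:R); apply: val_inj.
- by move=> x i; rewrite !mxE quat_coord_star eP.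
Qed.

Lemma oppr_fixed (R : numDomainType) (x : R) : - x = x -> x = 0.
Proof. by move/eqP; rewrite eqNr => /eqP. Qed.

(** * The matrices of the elements of the perturbation semigroup *)

Section PertMatrix.
Variables (F : numFieldType) (A : starAlgType F) (m l : nat).
Local Notation d := (1 + (m + l))%N.
Variables (k : {linear A -> 'cV[F]_d}) (k' : {linear 'cV[F]_d -> A}).
Hypotheses (kK : cancel k k') (k'K : cancel k' k).
Hypothesis k1 : k 1 = delta_mx 0 0.
Hypothesis k_star :
  forall x i, k (star x) i 0 = if (i < m.+1)%N then k x i 0 else - k x i 0.
Hypothesis act_surj : forall f : {linear A -> A}, exists t, act t =1 f.

(** As star(a y b) = star(b) star(y) star(a), replacing each a ⊗ b° by star(b) ⊗ star(a)° conjugates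
    the action by [star]. Injectivity of the action then turns commutation with [star] into the
    equality of tensors required by [in_pert]. *)
Lemma in_pertP (t : tensor A A^c) :
  in_pert t <-> act t 1 = 1 /\ forall y, act t (star y) = star (act t y).
Proof.
have star_sum (s : seq (A * A)) y :
    star (act (\sum_(p <- s) tens p.1 (p.2 : A^c)) y) =
    act (\sum_(p <- s) tens (star p.2) (star p.1 : A^c)) (star y).
  have star0 : star 0 = 0 :> A by apply: (addrI (star 0)); rewrite -starD !addr0.
  rewrite act_sum act_suml (big_morph _ (@starD _ A) star0).
  by apply: eq_bigr => p _; rewrite act_tens !starM mulrA.
split=> [[s [-> s1 sS]]|[t1 tS]].
  split=> [|y]; last by rewrite star_sum -sS.
  by rewrite act_sum -[RHS]s1; apply: eq_bigr => p _; rewrite mulr1.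
have [s tE] := tensor_sum t; exists s; split=> //.
  by rewrite -[RHS]t1 tE act_sum; apply: eq_bigr => p _; rewrite mulr1.
apply: (act_inj kK k'K act_surj) => y.
by rewrite -[y]starK -star_sum -tE -tS starK.
Qed.

Definition pert_mx (x : pert A) : 'M[F]_d := coord_mx k k' (act (val x)).

Lemma pert_mx_inj : injective pert_mx.
Proof.
move=> x y /(coord_mx_inj kK) xy; apply: val_inj.
exact: (act_inj kK k'K act_surj).
Qed.

Lemma pert_mxM x y : pert_mx (x * y)%g = pert_mx x *m pert_mx y.
Proof.
apply/matrixP => i j; rewrite mxE [act _ _]actM -(coord_mxE kK) -/(pert_mx x).
by rewrite -(coord_mxE kK) k'K mulmxA -colE mxE.
Qed.

(* The matrices of the linear maps that fix [1] and preserve both the Hermitian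
   and the skew-Hermitian elements. *)
Definition unital_mx (v : 'rV[F]_m) (B : 'M[F]_m) (C : 'M[F]_l) : 'M[F]_d :=
  block_mx 1%:M (row_mx v 0) 0 (block_mx B 0 0 C).

(** The upper right block of the product is the source of the law of V ⋊ S. *)
Lemma unital_mxM v B C v' B' C' :
  unital_mx v B C *m unital_mx v' B' C' =
  unital_mx (v' + v *m B') (B *m B') (C *m C').
Proof.
rewrite /unital_mx !mulmx_block mul_row_block !mul1mx !mulmx0 !mul0mx.
by rewrite !(addr0, add0r) add_row_mx addr0.
Qed.

Let sign_mx : 'M[F]_(m + l) := block_mx 1%:M 0 0 (- 1%:M).
Let star_mx : 'M[F]_d := block_mx 1%:M 0 0 sign_mx.

Let star_mxE x : k (star x) = star_mx *m k x.
Proof.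
have -> : k (star x) = col_mx (usubmx (k x))
    (col_mx (usubmx (dsubmx (k x))) (- dsubmx (dsubmx (k x)))).
  apply/colP => i; rewrite k_star mxE.
  case: splitP => [i0 i_i0|i1 i_i1]; rewrite mxE.
    by rewrite i_i0 [i0]ord1 /=; congr (k x _ 0); apply: val_inj; rewrite /= i_i0 [i0]ord1.
  rewrite i_i1; case: splitP => i2 i_i2; rewrite !mxE.
    by rewrite add1n ltnS i_i2 ltn_ord; congr (k x _ 0); apply: val_inj; rewrite /= i_i1 i_i2.
  rewrite add1n ltnS i_i2 ltnNge leq_addr /=; congr (- k x _ 0); apply: val_inj.
  by rewrite /= i_i1 i_i2.
rewrite -[in RHS](vsubmxK (k x)) -[in RHS](vsubmxK (dsubmx (k x))) !mul_block_col.
by rewrite !mul1mx !mul0mx !(addr0, add0r) mulNmx mul1mx.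
Qed.

Let mxN_eq0 p q (M : 'M[F]_(p, q)) : - M = M -> M = 0.
Proof.
by move/matrixP=> NM; apply/matrixP => i j; rewrite mxE; apply: oppr_fixed; rewrite -{2}NM mxE.
Qed.

Let mx_coord_ext (D D' : 'M[F]_d) : (forall y, D *m k y = D' *m k y) -> D = D'.
Proof.
move=> DD'; apply/matrixP => i j.
by have := DD' (k' (delta_mx j 0)); rewrite k'K -!colE => /colP/(_ i); rewrite !mxE.
Qed.

Let e0E : delta_mx 0 0 = col_mx 1%:M 0 :> 'cV[F]_d.
Proof.
apply/colP => i; rewrite !mxE andbT -val_eqE /=.
by case: splitP => i1 ->; rewrite !mxE // [i1]ord1.
Qed.

(** Fixing 1 determines the first column. Commuting with [star_mx] forces each block X between the
    two eigenspaces of the involution to satisfy -X = X, hence to vanish. *)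
Lemma pert_mx_unital x : exists v B C, pert_mx x = unital_mx v B C.
Proof.
have /in_pertP[x1 xS] := asboolW (valP x); set M := pert_mx x.
have M1 : M *m delta_mx 0 0 = delta_mx 0 0 :> 'cV_d.
  rewrite -k1 (coord_mxE kK). exact (congr1 (fun z => k z) x1).
have MS : M *m star_mx = star_mx *m M.
  apply: mx_coord_ext => y; rewrite -!mulmxA -star_mxE !(coord_mxE kK) -star_mxE.
  exact (congr1 (fun z => k z) (xS y)).
exists (lsubmx (ursubmx M)), (ulsubmx (drsubmx M)), (drsubmx (drsubmx M)).
move: M1 MS; rewrite e0E -{1 2 3}(submxK M) mul_block_col !mulmx_block.
rewrite !(mul1mx, mulmx1, mulmx0, mul0mx, addr0, add0r).
case/eq_col_mx => ul1 dl0 /eq_block_mx[_ ur _ dr].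
rewrite -[LHS]submxK ul1 dl0; congr block_mx; last first.
  rewrite -[LHS]submxK; move: dr; rewrite -{1 2}(submxK (drsubmx M)) !mulmx_block.
  rewrite !(mul1mx, mulmx1, mulmx0, mul0mx, addr0, add0r, mulmxN, mulNmx).
  by case/eq_block_mx => _ /mxN_eq0 -> /esym/mxN_eq0 -> _.
rewrite -[LHS]hsubmxK; move: ur; rewrite -{1 2}(hsubmxK (ursubmx M)) mul_row_block.
rewrite !(mulmx1, mulmx0, addr0, add0r, mulmxN).
by case/eq_row_mx => _ /mxN_eq0 ->.
Qed.

(** Surjectivity of the action yields a tensor with this matrix; the criterion [in_pertP] is then a
    block computation. *)
Lemma unital_mx_pert v B C : exists x, pert_mx x = unital_mx v B C.
Proof.
have [t tE] := act_surj (mx_coord k k' (unital_mx v B C)).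
have tM y : k (act t y) = unital_mx v B C *m k y by rewrite tE k'K.
have t_pert : in_pert t.
  apply/in_pertP; split=> [|y]; apply: (can_inj kK).
    rewrite tM k1 /unital_mx e0E mul_block_col.
    by rewrite !(mulmx1, mulmx0, mul0mx, addr0).
  rewrite tM !star_mxE tM !mulmxA; congr (_ *m _).
  rewrite !mulmx_block mul_row_block !(mul1mx, mulmx1, mulmx0, mul0mx, addr0, add0r).
  by rewrite mulmxN mulNmx mulmx1 mul1mx.
exists (Pert (asboolT t_pert)); rewrite /pert_mx /=.
by rewrite -[RHS](mx_coordK k'K); apply/matrixP => i j; rewrite !mxE tE.
Qed.

End PertMatrix.

(** * Passage from real to twisted matrices *)

Section Twist.
Variables (R : rcfType) (m : nat) (b : pred 'I_m).
Local Open Scope complex_scope.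
Local Notation P := (diag_mx (\row_j (if b j then 1 else -1)) : 'M[R[i]]_m).

(* A square root of the [j]-th diagonal entry of [P]. *)
Let s j : R[i] := if b j then 1 else 'i.

(** With D the diagonal matrix of the [s j], these two maps are v ↦ v D and B ↦ D^-1 B D, because
    the inverse of [s j] is its conjugate; hence they respect products. *)
Definition twist_vec (v : 'rV[R]_m) : 'rV[R[i]]_m :=
  \row_j ((v 0 j)%:C * s j).
Definition twist_mx (B : 'M[R]_m) : 'M[R[i]]_m :=
  \matrix_(i, j) ((s i)^* * (B i j)%:C * s j).

Lemma twisted_rVP (v : 'rV[R[i]]_m) :
  reflect (forall j, (v 0 j)^* = v 0 j * (if b j then 1 else -1))
    (v \in twisted_rV P).
Proof.
apply: (iffP eqP) => [/rowP vP j|vP]; first by move: (vP j); rewrite mul_mx_diag !mxE.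
by apply/rowP => j; rewrite mul_mx_diag !mxE vP.
Qed.

Lemma twisted_MP (B : 'M[R[i]]_m) :
  reflect (forall i j, (if b i then 1 else -1) * (B i j)^* =
                       B i j * (if b j then 1 else -1))
    (B \in twisted_M P).
Proof.
apply: (iffP eqP) => [/matrixP BP i j|BP].
  by move: (BP i j); rewrite mul_mx_diag mul_diag_mx !mxE.
by apply/matrixP => i j; rewrite mul_mx_diag mul_diag_mx !mxE BP.
Qed.

Lemma twist_vec_twisted v : twist_vec v \in twisted_rV P.
Proof.
apply/twisted_rVP => j; rewrite mxE /s; case: (b j); simpc => //.
Qed.

Lemma twist_mx_twisted B : twist_mx B \in twisted_M P.
Proof.
by apply/twisted_MP => i j; rewrite mxE /s; case: (b i); case: (b j); simpc.
Qed.

Definition to_twisted_vec v : twisted_vec P := TwistedVec (twist_vec_twisted v).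
Definition to_twisted_mx B : twisted_mx P := TwistedMx (twist_mx_twisted B).

(** The twisting condition makes each entry real or purely imaginary according to [b j]. Multiplied
    by the conjugate of [s j] it becomes real, and [complex.Re] loses nothing. *)
Lemma to_twisted_vec_bij : bijective to_twisted_vec.
Proof.
exists (fun v => \row_j complex.Re (tvec_val v 0 j * (s j)^*)) => [v|v].
  by apply/rowP => j; rewrite !mxE /s; case: (b j); simpc.
apply: val_inj; apply/rowP => j; rewrite !mxE /s.
have /twisted_rVP/(_ j) := valP v => /=.
case: (tvec_val v 0 j) => x y; case: (b j); simpc.
  by case=> /oppr_fixed ->.
by case=> /esym/oppr_fixed ->.
Qed.

(** Here an entry is real when [b i] = [b j] and purely imaginary otherwise, so that D B D^-1 is
    real. *)
Lemma to_twisted_mx_bij : bijective to_twisted_mx.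
Proof.
exists (fun B => \matrix_(i, j) complex.Re (s i * tmx_val B i j * (s j)^*)) => [B|B].
  by apply/matrixP => i j; rewrite !mxE /s; case: (b i); case: (b j); simpc.
apply: val_inj; apply/matrixP => i j; rewrite !mxE /s.
have /twisted_MP/(_ i j) := valP B => /=.
case: (tmx_val B i j) => x y; case: (b i); case: (b j); simpc.
- by case=> /oppr_fixed ->.
- by case=> /esym/oppr_fixed ->.
- by case=> /oppr_fixed ->.
- by case=> /esym/oppr_fixed ->.
Qed.

Let sJ j : s j * (s j)^* = 1.
Proof. by rewrite /s; case: (b j); simpc. Qed.

Lemma to_twisted_vecD : {morph to_twisted_vec : u v / u + v}.
Proof.
by move=> u v; apply: val_inj; apply/rowP => j; rewrite !mxE rmorphD mulrDl.
Qed.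

Lemma to_twisted_vecM v B :
  to_twisted_vec (v *m B) = tvec_act (to_twisted_vec v) (to_twisted_mx B).
Proof.
apply: val_inj; apply/rowP => j; rewrite !mxE rmorph_sum mulr_suml.
apply: eq_bigr => i _; rewrite !mxE rmorphM.
by rewrite -!mulrA [s i * _]mulrA sJ mul1r.
Qed.

Lemma to_twisted_mxM : {morph to_twisted_mx : B C / B *m C >-> (B * C)%g}.
Proof.
move=> B C; apply: val_inj; apply/matrixP => i j; rewrite !mxE rmorph_sum.
rewrite mulr_sumr mulr_suml; apply: eq_bigr => k _; rewrite !mxE rmorphM.
by rewrite -!mulrA [s k * _]mulrA sJ mul1r.
Qed.

End Twist.

(** * Assembly of the isomorphism *)

Lemma castmx_signature (R : pzRingType) (p q m : nat) (e : (p + q = m)%N) :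
  castmx (e, e) (block_mx (1%:M : 'M[R]_p) 0 0 (- 1%:M : 'M_q)) =
  diag_mx (\row_(j < m) (if (j < p)%N then 1 else -1)).
Proof.
case: m / e; rewrite castmx_id; apply/matrixP => i j; rewrite !mxE -val_eqE.
case: splitP => i1 /= Ei; rewrite mxE; case: splitP => j1 /= Ej; rewrite !mxE Ei Ej //.
- by rewrite ltn_eqF // ltn_addr.
- by rewrite gtn_eqF // ltn_addr.
- by rewrite eqn_add2l mulNrn.
Qed.

Lemma inj_surj_bijective (T U : choiceType) (f : T -> U) :
  injective f -> (forall y, exists x, f x = y) -> bijective f.
Proof.
move=> f_inj /choice[g gK]; exists g => // x.
by apply: f_inj; rewrite gK.
Qed.

Theorem proposition3p19 (R : realType) (n : nat) :
  let N := n.+1 in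
  exists2 f : pert (quatmx R N) ->
              (semidirect (Psi' R N) * twisted_mx (Theta' R N))%type,
    bijective f & {morph f : x y / (x * y)%g}.
Proof.
(* Both signatures take the form of a diagonal of signs given by a boolean predicate, as the
   twisting maps require. *)
move=> N; rewrite /Psi' /Theta' !castmx_signature.
have [k [k' [kK k'K k1 k_star]]] := quatmx_coordinates R n.
have act_surj := @quatmx_act_surj R n.
pose b1 (j : 'I_((2 * N + 1) * (N - 1))) := (j < N ^ 2 - 1)%N.
pose b2 (j : 'I_(N * (2 * N + 1))) := (j < N ^ 2)%N.
(* Reading off blocks avoids choosing v, B and C; [fE] evaluates the result once the matrix is known
   to be unital. *)
pose f (x : pert (quatmx R N)) :=
  let M := pert_mx k k' x in
  ((to_twisted_vec b1 (lsubmx (ursubmx M)), to_twisted_mx b1 (ulsubmx (drsubmx M)))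
     : semidirect _, to_twisted_mx b2 (drsubmx (drsubmx M))).
have fE x v B C : pert_mx k k' x = unital_mx v B C ->
    f x = ((to_twisted_vec b1 v, to_twisted_mx b1 B) : semidirect _, to_twisted_mx b2 C).
  by rewrite /f => ->; rewrite /unital_mx block_mxKur !block_mxKdr block_mxKul row_mxKl.
have pertP := pert_mx_unital kK k'K k1 k_star act_surj.
have v_bij := @to_twisted_vec_bij R _ b1.
have B_bij := @to_twisted_mx_bij R _ b1.
have C_bij := @to_twisted_mx_bij R _ b2.
exists f; last first.
  move=> x y; have [[v [B [C xE]]] [v' [B' [C' yE]]]] := (pertP x, pertP y).
  have xyE := pert_mxM kK k'K x y; rewrite xE yE unital_mxM in xyE.
  by rewrite (fE _ _ _ _ xE) (fE _ _ _ _ yE) (fE _ _ _ _ xyE) to_twisted_vecD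
    to_twisted_vecM !to_twisted_mxM.
apply: inj_surj_bijective => [x y|[[v B] C]].
  have [[v [B [C xE]]] [v' [B' [C' yE]]]] := (pertP x, pertP y).
  rewrite (fE _ _ _ _ xE) (fE _ _ _ _ yE) => fxy.
  have /(bij_inj v_bij) vv := congr1 (fun z => z.1.1) fxy.
  have /(bij_inj B_bij) BB := congr1 (fun z => z.1.2) fxy.
  have /(bij_inj C_bij) CC := congr1 snd fxy.
  by apply: (pert_mx_inj kK k'K act_surj); rewrite xE yE vv BB CC.
have [v' _ v'K] := v_bij; have [B' _ B'K] := B_bij; have [C' _ C'K] := C_bij.
have [x /fE xE] := unital_mx_pert kK k'K k1 k_star act_surj (v' v) (B' B) (C' C).
by exists x; rewrite xE v'K B'K C'K.
Qed.
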